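(* Let $H$ be a pure integral Hodge structure of weight $-1$ and let $B$ be a biextension of $H$. Let $P_B$ be any period matrix of $B$. Then $\mathrm{ht}(B)=\mathrm{ht}(P_B)$, i.e. writing $$P_B=\begin{pmatrix} b & P_H & 0\\ c & a & 1\end{pmatrix},\qquad P_H\in\mathbb{C}^{k\times2k},\ a\in\mathbb{C}^{1\times2k},\ b\in\mathbb{C}^{k\times1},\ c\in\mathbb{C},$$ the height of $B$ (in the sense of Hain) equals $$-2\pi\left(\operatorname{Im}c-\operatorname{Im}a\cdot\begin{pmatrix}\operatorname{Im}P_H\\ \operatorname{Re}P_H\end{pmatrix}^{-1}\cdot\begin{pmatrix}\operatorname{Im}b\\ \operatorname{Re}b\end{pmatrix}\right).$$
   Context: Let $2k$ be the rank of $H_\mathbb{Z}$. A **biextension** of $H$ is an integral mixed Hodge structure $B$ (with weight filtration defined on $B_\mathbb{Z}$) together with an identification of weight graded pieces $\mathrm{Gr}^WB=\mathbb{Z}(1)\oplus H\oplus\mathbb{Z}$, where $\mathbb Z(1)=2\pi i\,\mathbb Z\subset\mathbb C$. **Height of $B$.** For $c'\in\mathbb{R}$ let $\varphi(c')$ be the real mixed Hodge structure with underlying space $\mathbb{R}(1)\oplus H_\mathbb{R}\oplus\mathbb{R}$ ($\mathbb R(1)=2\pi i\,\mathbb R\subset\mathbb C$), obvious weight filtration, Hodge pieces $F^j$ for $j\ne0$ coming from the direct sum, and $F^0=F^0H_\mathbb{C}+\mathbb{C}\,(c',0,1)$. The map $\varphi$ is a bijection from $\mathbb{R}$ to isomorphism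 classes of real biextensions of $H_\mathbb{R}$ (isomorphisms inducing the identity on weight graded pieces). The height $\mathrm{ht}(B)$ is the unique $c'\in\mathbb{R}$ such that the real biextension underlying $B$ (forget the integral structure) is isomorphic to $\varphi(c')$. **Period matrix.** Let $\gamma^0,\dots,\gamma^{2k+1}$ be a basis of $B_\mathbb{Z}$ respecting the weight filtration: $\gamma^0=2\pi i\in\mathbb{Z}(1)=W_{-2}B$; $\gamma^1,\dots,\gamma^{2k}\in W_{-1}B$ map to a basis of $H_\mathbb{Z}$ modulo $W_{-2}B$; $\gamma^{2k+1}$ maps to $1\in\mathbb{Z}$ modulo $W_{-1}B$. Let $\omega_1,\dots,\omega_{k+1}$ be a basis of $F^0B$ respecting the weight filtration: $\omega_1,\dots,\omega_k\in W_{-1}B\otimes\mathbb{C}$ map to a basis of $F^0H$ modulo $W_{-2}B\otimes\mathbb{C}$; $\omega_{k+1}$ maps to $1$ modulo $W_{-1}B\otimes\mathbb{C}$. Write $\omega_i=\sum_ja_{ij}\gamma^j$. Then $P_B=(a_{ij})_{1\le i\le k+1,\,0\le j\le2k+1}$ is a period matrix of $B$; it has the block shape displayed in the claim (columns grouped as $1$, $2k$, $1$; rows as $k$, $1$). Real and imaginary parts of matrices are taken entrywise. *)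

(* Defs.v *)
From HB Require Import structures.
From mathcomp Require Import all_boot all_order all_algebra.
From mathcomp Require Import complex zify.
From mathcomp Require Import all_classical all_reals all_analysis.

Set Implicit Arguments.
Unset Strict Implicit.
Unset Printing Implicit Defensive.

Import Order.TTheory GRing.Theory Num.Theory.

Local Open Scope classical_set_scope.
Local Open Scope complex_scope.
Local Open Scope ring_scope.

Section RealStructures.
Variable R : realType.

(* A finite-dimensional real vector space is represented by its
   complexification V together with complex conjugation; the real space
   itself is the set of fixed points of rv_conj. *)
Record realVect := RealVect {
  rv_space :> vectType R[i];
  rv_conj : rv_space -> rv_space;
  rv_conj_antilinear : forall (a : R[i]) (u v : rv_space),
    rv_conj (a *: u + v) = conjc a *: rv_conj u + rv_conj v;
  rv_conjK : involutive rv_conj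
}.

Definition conjv (V : realVect) (U : {vspace V}) : {vspace V} :=
  <<map (@rv_conj V) (vbasis U)>>%VS.

Lemma rv_conjD (V : realVect) (u v : V) :
  rv_conj (u + v) = rv_conj u + rv_conj v.
Proof.
by have := rv_conj_antilinear 1 u v; rewrite !scale1r rmorph1 scale1r.
Qed.

Lemma rv_conj0 (V : realVect) : rv_conj (0 : V) = 0.
Proof. by apply: (addrI (rv_conj (0 : V))); rewrite -rv_conjD !addr0. Qed.

Lemma rv_conjZ (V : realVect) a (u : V) :
  rv_conj (a *: u) = conjc a *: rv_conj u.
Proof. by have := rv_conj_antilinear a u 0; rewrite !addr0 rv_conj0 addr0. Qed.

Lemma rv_conj_sum (V : realVect) n (a : 'I_n -> R[i]) (u : 'I_n -> V) :
  rv_conj (\sum_i a i *: u i) = \sum_i conjc (a i) *: rv_conj (u i).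
Proof.
elim: n a u => [|n IH] a u; first by rewrite !big_ord0 rv_conj0.
by rewrite !big_ord_recl rv_conjD rv_conjZ IH.
Qed.

Lemma memv_conjv (V : realVect) (U : {vspace V}) v :
  (v \in conjv U) = (rv_conj v \in U).
Proof.
have sub (X : seq V) (W : {vspace V}) w :
    {subset map (@rv_conj V) X <= W} -> w \in <<X>>%VS -> rv_conj w \in W.
  move=> sXW wX; rewrite (coord_span (X := in_tuple X) wX) rv_conj_sum.
  apply: memv_suml => i _; apply: memvZ; apply: sXW.
  by apply: map_f; rewrite mem_nth.
apply/idP/idP => [|vU].
  apply: sub => _ /mapP[_ /mapP[u uU ->] ->]; rewrite rv_conjK.
  exact: vbasis_mem.
rewrite -[v]rv_conjK; apply: (sub (vbasis U)).
  by move=> w wU; apply: memv_span.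
by rewrite (span_basis (vbasisP U)).
Qed.

Record realHS (n : int) := RealHS {
  hs_space :> realVect;
  hs_F : int -> {vspace hs_space};
  hs_F_decr : forall p q, p <= q -> (hs_F q <= hs_F p)%VS;
  hs_F_exhaustive : exists p, hs_F p = fullv;
  hs_F_separated : exists p, hs_F p = 0%VS;
  hs_opposed : forall p,
    (hs_F p + conjv (hs_F (n + 1 - p)) = fullv)%VS /\
    (hs_F p :&: conjv (hs_F (n + 1 - p)) = 0)%VS
}.

(* The inverse image in W_n of F^p Gr_n^W. *)
Definition gr_F (V : vectType R[i]) (W F : int -> {vspace V}) (n p : int) :=
  (F p :&: W n + W (n - 1))%VS.

(* mhs_pure says that the filtration induced by F on W_n / W_{n-1} is a pure
   Hodge structure of weight n, written out with subspaces of W_n containing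
   W_{n-1}. *)
Record realMHS := RealMHS {
  mhs_space :> realVect;
  mhs_W : int -> {vspace mhs_space};
  mhs_F : int -> {vspace mhs_space};
  mhs_W_incr : forall m n, m <= n -> (mhs_W m <= mhs_W n)%VS;
  mhs_W_exhaustive : exists n, mhs_W n = fullv;
  mhs_W_separated : exists n, mhs_W n = 0%VS;
  mhs_W_conj : forall n, conjv (mhs_W n) = mhs_W n;
  mhs_F_decr : forall p q, p <= q -> (mhs_F q <= mhs_F p)%VS;
  mhs_F_exhaustive : exists p, mhs_F p = fullv;
  mhs_F_separated : exists p, mhs_F p = 0%VS;
  mhs_pure : forall n p,
    let A := gr_F mhs_W mhs_F n in
    (A p + conjv (A (n + 1 - p)) = mhs_W n)%VS /\
    (A p :&: conjv (A (n + 1 - p)) = mhs_W (n - 1))%VS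
}.

Definition int_span (V : vectType R[i]) n (e : 'I_n -> V) : set V :=
  [set v | exists z : 'I_n -> int, v = \sum_i (z i)%:~R *: e i].

Definition int_basis (V : vectType R[i]) n (e : 'I_n -> V) (L : set V) :=
  L = int_span e /\
  forall z : 'I_n -> int, \sum_i (z i)%:~R *: e i = 0 -> forall i, z i = 0.

(* L is a free abelian group of finite rank whose complexification is V,
   compatibly with the conjugation of V. *)
Definition is_lattice (V : realVect) (L : set V) :=
  (exists n (e : n.-tuple V), basis_of fullv e /\ L = int_span (tnth e)) /\
  forall v, L v -> rv_conj v = v.

Record intHS (n : int) := IntHS {
  ihs_real :> realHS n;
  ihs_lat : set ihs_real;
  ihs_latP : is_lattice ihs_lat
}.

(* W_n B_Z is imhs_lat `&` mhs_W n; imhs_W_lat says that W is defined on the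
   lattice. *)
Record intMHS := IntMHS {
  imhs_real :> realMHS;
  imhs_lat : set imhs_real;
  imhs_latP : is_lattice imhs_lat;
  imhs_W_lat : forall n, exists e : seq imhs_real,
    (forall v, v \in e -> imhs_lat v) /\ mhs_W imhs_real n = <<e>>%VS
}.

(* An isomorphism of real Hodge structures Gr_n^W M = H, given as a surjection
   from W_n M with kernel W_{n-1} M. *)
Record gr_ident (M : realMHS) (n : int) (H : realHS n) := GrIdent {
  gr_map :> 'Hom(subvs_of (mhs_W M n), H);
  gr_surj : limg gr_map = fullv;
  gr_ker : lker gr_map = (linfun vsval @^-1: mhs_W M (n - 1))%VS;
  gr_conj : forall w w' : subvs_of (mhs_W M n),
    vsval w' = rv_conj (vsval w) -> gr_map w' = rv_conj (gr_map w);
  gr_mapF : forall p,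
    (gr_map @: (linfun vsval @^-1: mhs_F M p) = hs_F H p)%VS
}.

Definition gr_ident_int (M : intMHS) (n : int) (H : intHS n)
    (g : gr_ident M H) :=
  [set g w | w in [set w | imhs_lat (vsval w)]] = @ihs_lat n H.

(* The class of v \in mhs_W M n in Gr_n^W M = H. *)
Definition gr_class (M : realMHS) (n : int) (H : realHS n)
    (g : gr_ident M H) (v : M) : H := g (vsproj (mhs_W M n) v).

End RealStructures.

Section Tate.
Variable R : realType.

Definition tate_gen (m : nat) : R[i] := (0 +i* (2 * pi)) ^+ m.

Lemma tate_gen_neq0 m : tate_gen m != 0.
Proof.
rewrite expf_neq0 // eq_complex /= eqxx /= mulf_neq0 ?pnatr_eq0 //.
by rewrite gt_eqF // pi_gt0.
Qed.

Definition tate_conj (m : nat) (z : R[i]^o) : R[i]^o :=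
  tate_gen m * conjc (z / tate_gen m).

Lemma tate_conj_antilinear m (a : R[i]) (u v : R[i]^o) :
  tate_conj m (a *: u + v) = conjc a *: tate_conj m u + tate_conj m v.
Proof.
rewrite /tate_conj mulrDl rmorphD mulrDr; congr (_ + _).
by rewrite -scalerAl rmorphM mulrCA.
Qed.

Lemma tate_conjK m : involutive (tate_conj m).
Proof.
move=> z; rewrite /tate_conj mulrAC divff ?tate_gen_neq0 // mul1r conjcK.
by rewrite mulrC divfK ?tate_gen_neq0.
Qed.

Definition tate_vect (m : nat) : realVect R :=
  RealVect (@tate_conj_antilinear m) (@tate_conjK m).

Definition tate_F (m : nat) (p : int) : {vspace tate_vect m} :=
  if p <= - m%:Z then fullv else 0%VS.

Lemma tate_F_decr m p q : p <= q -> (tate_F m q <= tate_F m p)%VS.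
Proof.
rewrite /tate_F => pq; case: ifP => [qm|_]; last exact: sub0v.
by rewrite (le_trans pq qm).
Qed.

Lemma tate_F_exhaustive m : exists p, tate_F m p = fullv.
Proof. by exists (- m%:Z); rewrite /tate_F lexx. Qed.

Lemma tate_F_separated m : exists p, tate_F m p = 0%VS.
Proof. by exists (- m%:Z + 1); rewrite /tate_F gerDl. Qed.

Lemma conjv_full (V : realVect R) : conjv (fullv : {vspace V}) = fullv.
Proof. by apply/vspaceP => v; rewrite memv_conjv !memvf. Qed.

Lemma conjv0 (V : realVect R) : conjv (0%VS : {vspace V}) = 0%VS.
Proof.
apply/vspaceP => v; rewrite memv_conjv !memv0; apply/eqP/eqP => [v0|->].
  by rewrite -[v]rv_conjK v0 rv_conj0.
exact: rv_conj0.
Qed.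

Lemma tate_opposed m p :
  (tate_F m p + conjv (tate_F m (- (m.*2)%:Z + 1 - p)) = fullv)%VS /\
  (tate_F m p :&: conjv (tate_F m (- (m.*2)%:Z + 1 - p)) = 0)%VS.
Proof.
have -> : tate_F m (- (m.*2)%:Z + 1 - p) =
    if p <= - m%:Z then 0%VS else fullv.
  rewrite /tate_F -addnn PoszD.
  by case: (lerP p (- m%:Z)) => h; case: ifP => // h'; exfalso; lia.
rewrite /tate_F; case: ifP => _; rewrite ?conjv_full ?conjv0.
  by rewrite addv0 capv0.
by rewrite add0v cap0v.
Qed.

(* Complexification of R(m) = (2 pi i)^m R, identified with the complex
   numbers by multiplication. *)
Definition tate (m : nat) : realHS R (- (m.*2)%:Z) :=
  RealHS (@tate_F_decr m) (@tate_F_exhaustive m) (@tate_F_separated m)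
         (@tate_opposed m).

Definition tate_lat (m : nat) : set (tate m) :=
  [set v | exists z : int, v = z%:~R * tate_gen m].

Lemma tate_latP m : is_lattice (@tate_lat m).
Proof.
split; last first.
  move=> _ [z ->] /=; rewrite /tate_conj mulfK ?tate_gen_neq0 //.
  by rewrite rmorph_int mulrC.
exists 1%N, [tuple (tate_gen m : tate m)]; split.
  rewrite basisEdim /= dimvf /dim /= andbT.
  apply/subvP => v _; rewrite span_seq1; apply/vlineP.
  exists (v / tate_gen m); rewrite /GRing.scale /= divfK //.
  exact: tate_gen_neq0.
apply/seteqP; split => v /= [z ->].
  by exists (fun=> z); rewrite big_ord1.
by exists (z ord0); rewrite big_ord1.
Qed.

Definition int_tate (m : nat) : intHS R (- (m.*2)%:Z) := IntHS (@tate_latP m).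

End Tate.

Section Biextensions.
Variable R : realType.

(* Gr^W M = R(1) + H + R(0). *)
Record biext_grading (M : realMHS R) (H : realHS R (-1)) := BiextGrading {
  bg_W_bot : mhs_W M (-3) = 0%VS;
  bg_W_top : mhs_W M 0 = fullv;
  bg_gr2 : gr_ident M (tate R 1);
  bg_gr1 : gr_ident M H;
  bg_gr0 : gr_ident M (tate R 0)
}.

Record realBiext (H : realHS R (-1)) := RealBiext {
  rb_mhs :> realMHS R;
  rb_grading : biext_grading rb_mhs H
}.

Record biext (H : intHS R (-1)) := Biext {
  be_mhs :> intMHS R;
  be_grading : biext_grading be_mhs H;
  be_int2 : gr_ident_int (M := be_mhs) (H := int_tate R 1) (bg_gr2 be_grading);
  be_int1 : gr_ident_int (M := be_mhs) (H := H) (bg_gr1 be_grading);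
  be_int0 : gr_ident_int (M := be_mhs) (H := int_tate R 0) (bg_gr0 be_grading)
}.

Definition real_biext (H : intHS R (-1)) (B : biext H) : realBiext H :=
  RealBiext (be_grading B).

Definition gr_compat (M N : realMHS R) (f : 'Hom(M, N)) (n : int)
    (H : realHS R n) (gM : gr_ident M H) (gN : gr_ident N H) :=
  forall v, v \in mhs_W M n -> gr_class gN (f v) = gr_class gM v.

Definition biext_isom (H : realHS R (-1)) (X Y : realBiext H) :=
  exists f : 'Hom(X, Y),
    [/\ lker f = 0%VS /\ limg f = fullv,
        forall v, f (rv_conj v) = rv_conj (f v),
        forall n, (f @: mhs_W X n = mhs_W Y n)%VS,
        forall p, (f @: mhs_F X p = mhs_F Y p)%VS
      & [/\ gr_compat f (bg_gr2 (rb_grading X)) (bg_gr2 (rb_grading Y)),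
            gr_compat f (bg_gr1 (rb_grading X)) (bg_gr1 (rb_grading Y))
          & gr_compat f (bg_gr0 (rb_grading X)) (bg_gr0 (rb_grading Y))]].

End Biextensions.

Section SplitGradedPiece.
Variable R : realType.

(* g restricts to an identification of Gr_n^W V with H. *)
Record splits_gr (V : realVect R) (W F : int -> {vspace V}) (n : int)
    (H : realHS R n) (g : 'Hom(V, H)) : Prop := SplitsGr {
  sg_conj : forall v, g (rv_conj v) = rv_conj (g v);
  sg_ker : forall v, v \in W n -> (g v == 0) = (v \in W (n - 1));
  sg_lift : forall x, exists2 v, v \in W n & g v = x;
  sg_F : forall p v, v \in (F p :&: W n)%VS -> g v \in hs_F H p;
  sg_F_lift : forall p x, x \in hs_F H p ->
    exists2 v, v \in (F p :&: W n)%VS & g v = x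
}.

Lemma splits_gr_F (V : realVect R) (W F : int -> {vspace V}) n
    (H : realHS R n) (g : 'Hom(V, H)) p v :
  (W (n - 1) <= W n)%VS -> splits_gr W F g -> v \in W n ->
  (v \in gr_F W F n p) = (g v \in hs_F H p).
Proof.
move=> sW [gc gk gl gF gFl] vW; apply/idP/idP.
  case/memv_addP=> x xF [y yW ->]; rewrite linearD /=.
  have /eqP-> : g y == 0 by rewrite gk // (subvP sW).
  by rewrite addr0 gF.
case/gFl=> x xF gx; rewrite -(subrK x v) addrC memv_add //.
have xW : x \in W n by move: xF; rewrite memv_cap => /andP[].
by rewrite -gk ?rpredB // linearB /= gx subrr.
Qed.

Lemma splits_gr_pure (V : realVect R) (W F : int -> {vspace V}) n
    (H : realHS R n) (g : 'Hom(V, H)) :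
  (W (n - 1) <= W n)%VS -> (forall m, conjv (W m) = W m) ->
  splits_gr W F g ->
  forall p, let A := gr_F W F n in
  (A p + conjv (A (n + 1 - p)) = W n)%VS /\
  (A p :&: conjv (A (n + 1 - p)) = W (n - 1))%VS.
Proof.
move=> sW cW sg p A.
have AW q : (A q <= W n)%VS by rewrite subv_add sW capvSr.
have WA q : (W (n - 1)%R <= A q)%VS by rewrite addvSr.
have cWE m v : (rv_conj v \in W m) = (v \in W m) by rewrite -{2}cW memv_conjv.
have AE q v : v \in W n -> (v \in A q) = (g v \in hs_F H q).
  exact: splits_gr_F.
have [gc gk gl _ _] := sg; have [oD oI] := hs_opposed H p.
have cAE q v : v \in W n -> (v \in conjv (A q)) = (g v \in conjv (hs_F H q)).
  by move=> vW; rewrite !memv_conjv AE ?cWE // gc.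
split; apply/vspaceP => v; apply/idP/idP.
- case/memv_addP=> x xA [y]; rewrite memv_conjv => yA ->.
  rewrite rpredD //; first exact: (subvP (AW p)).
  by rewrite -cWE (subvP (AW _) _ yA).
- move=> vW; have : g v \in fullv by rewrite memvf.
  rewrite -oD => /memv_addP[x xF [y yF gv]].
  have [x' x'W gx'] := gl x.
  rewrite -(subrK x' v) addrC memv_add ?AE ?gx' //.
  by rewrite cAE ?rpredB // linearB /= gx' gv addrC addKr.
- rewrite memv_cap => /andP[vA vcA].
  have vW := subvP (AW p) _ vA.
  by rewrite -gk // -memv0 -oI memv_cap -AE // -cAE // vA.
move=> vW1; rewrite memv_cap memv_conjv.
by rewrite (subvP (WA p)) // (subvP (WA _)) // cWE.
Qed.

Section Ident.
Variables (M : realMHS R) (n : int) (H : realHS R n) (g : 'Hom(M, H)).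
Hypothesis sg : splits_gr (mhs_W M) (mhs_F M) g.

Let h : 'Hom(subvs_of (mhs_W M n), H) := (g \o linfun vsval)%VF.

Let hE w : h w = g (vsval w). Proof. by rewrite comp_lfunE lfunE. Qed.

Lemma split_gr_surj : limg h = fullv.
Proof.
apply/vspaceP => x; rewrite memvf; have [v vW <-] := sg_lift sg x.
by rewrite -(vsprojK vW) -hE memv_img ?memvf.
Qed.

Lemma split_gr_ker : lker h = (linfun vsval @^-1: mhs_W M (n - 1))%VS.
Proof.
apply/vspaceP => w; rewrite memv_ker hE -memv_preim lfunE.
by rewrite (sg_ker sg) // subvsP.
Qed.

Lemma split_gr_conj (w w' : subvs_of (mhs_W M n)) :
  vsval w' = rv_conj (vsval w) -> h w' = rv_conj (h w).
Proof. by move=> ww'; rewrite !hE ww' (sg_conj sg). Qed.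

Lemma split_gr_mapF p : (h @: (linfun vsval @^-1: mhs_F M p) = hs_F H p)%VS.
Proof.
apply/vspaceP => x; apply/memv_imgP/idP => [[w]|/(sg_F_lift sg)[v]].
  rewrite -memv_preim lfunE => wF ->.
  by rewrite hE (sg_F sg) // memv_cap wF subvsP.
rewrite memv_cap => /andP[vF vW] <-; exists (vsproj (mhs_W M n) v).
  by rewrite -memv_preim lfunE /= vsprojK.
by rewrite hE vsprojK.
Qed.

Definition split_gr_ident : gr_ident M H :=
  GrIdent split_gr_surj split_gr_ker split_gr_conj split_gr_mapF.

End Ident.
End SplitGradedPiece.

Section Phi.
Variables (R : realType) (H : realHS R (-1)) (c : R).

Local Notation T := (tate_vect R 1 * H * tate_vect R 0)%type.

Definition phi_conj (v : T) : T :=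
  (rv_conj v.1.1, rv_conj v.1.2, rv_conj v.2).

Lemma phi_conj_antilinear (a : R[i]) (u v : T) :
  phi_conj (a *: u + v) = conjc a *: phi_conj u + phi_conj v.
Proof.
case: u v => [[u2 u1] u0] [[v2 v1] v0].
exact: (f_equal2 pair (f_equal2 pair (rv_conj_antilinear a u2 v2)
  (rv_conj_antilinear a u1 v1)) (rv_conj_antilinear a u0 v0)).
Qed.

Lemma phi_conjK : involutive phi_conj.
Proof.
move=> [[x y] z].
exact: (f_equal2 pair (f_equal2 pair (rv_conjK x) (rv_conjK y)) (rv_conjK z)).
Qed.

Definition phi_vect : realVect R := RealVect phi_conj_antilinear phi_conjK.

Definition phi_pr2 : 'Hom(phi_vect, tate R 1) := linfun (fst \o fst : T -> _).
Definition phi_pr1 : 'Hom(phi_vect, H) := linfun (snd \o fst : T -> _).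
Definition phi_pr0 : 'Hom(phi_vect, tate R 0) := linfun (snd : T -> _).

Definition dsum (U2 : {vspace tate R 1}) (U1 : {vspace H})
    (U0 : {vspace tate R 0}) : {vspace phi_vect} :=
  (phi_pr2 @^-1: U2 :&: phi_pr1 @^-1: U1 :&: phi_pr0 @^-1: U0)%VS.

Lemma phi_pr2E (v : phi_vect) : phi_pr2 v = v.1.1.
Proof. exact: lfunE. Qed.

Lemma phi_pr1E (v : phi_vect) : phi_pr1 v = v.1.2.
Proof. exact: lfunE. Qed.

Lemma phi_pr0E (v : phi_vect) : phi_pr0 v = v.2.
Proof. exact: lfunE. Qed.

Lemma memv_dsum U2 U1 U0 (v : phi_vect) :
  (v \in dsum U2 U1 U0) = [&& v.1.1 \in U2, v.1.2 \in U1 & v.2 \in U0].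
Proof.
rewrite (memv_cap v) (memv_cap v) andbA; congr (_ && _ && _).
- by rewrite -memv_preim phi_pr2E.
- by rewrite -memv_preim phi_pr1E.
by rewrite -memv_preim phi_pr0E.
Qed.

Definition phi_W (n : int) : {vspace phi_vect} :=
  dsum (if -2 <= n then fullv else 0%VS) (if -1 <= n then fullv else 0%VS)
       (if 0 <= n then fullv else 0%VS).

Definition phi_F (p : int) : {vspace phi_vect} :=
  if p == 0 then (dsum 0 (hs_F H 0) 0 + <[ ((c%:C, 0, 1)%R : T) ]>)%VS
  else dsum (hs_F (tate R 1) p) (hs_F H p) (hs_F (tate R 0) p).

Lemma memv_tate_F m p (x : tate R m) :
  (x \in tate_F R m p) = (p <= - m%:Z) || (x == 0).
Proof. by rewrite /tate_F; case: ifP; rewrite ?memvf ?memv0. Qed.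

Lemma memv_if (V : vectType R[i]) b (v : V) :
  (v \in (if b then fullv else 0%VS)) = b || (v == 0).
Proof. by case: b; rewrite ?memvf ?memv0. Qed.

Lemma memv_phi_W n (v : phi_vect) :
  (v \in phi_W n) = [&& (-2 <= n) || (v.1.1 == 0), (-1 <= n) || (v.1.2 == 0)
                      & (0 <= n) || (v.2 == 0)].
Proof. by rewrite memv_dsum !memv_if. Qed.

Lemma memv_phi_F p (v : phi_vect) :
  (v \in phi_F p) =
  if p == 0 then (v.1.1 == v.2 * c%:C) && (v.1.2 \in hs_F H 0)
  else [&& (p <= -1) || (v.1.1 == 0), v.1.2 \in hs_F H p
         & (p <= 0) || (v.2 == 0)].
Proof.
rewrite /phi_F; case: eqP => _; last first.
  by rewrite memv_dsum /= !memv_tate_F.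
case: v => [[x y] z] /=.
apply/memv_addP/andP => [[[[x' y'] z'] + [_ /vlineP[k ->]]]|[/eqP-> yF]].
  rewrite memv_dsum !memv0 /= => /and3P[/eqP-> yF /eqP->] [-> -> ->].
  by rewrite !add0r scaler0 addr0 /GRing.scale /= mulr1.
exists (0, y, 0); first by rewrite memv_dsum !memv0 !eqxx yF.
exists (z *: ((c%:C, 0, 1) : T)); first exact: memvZ (memv_line _).
by congr (_, _, _); rewrite /= ?scaler0 ?addr0 ?add0r // /GRing.scale /= mulr1.
Qed.

Lemma phi_W_incr m n : m <= n -> (phi_W m <= phi_W n)%VS.
Proof.
move=> mn; apply/subvP => -[[x y] z]; rewrite !memv_phi_W.
have mono (k : int) (b : bool) : (k <= m) || b -> (k <= n) || b.
  by case: b; rewrite ?orbT // !orbF => km; apply: le_trans mn.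
by case/and3P => /mono-> /mono-> /mono->.
Qed.

Lemma phi_W_bot : phi_W (-3) = 0%VS.
Proof.
apply/vspaceP => -[[x y] z]; rewrite memv_phi_W memv0 /=.
by apply/and3P/eqP => [[/eqP-> /eqP-> /eqP->]|[-> -> ->]].
Qed.

Lemma phi_W_top : phi_W 0 = fullv.
Proof. by apply/vspaceP => -[[x y] z]; rewrite memv_phi_W memvf. Qed.

Lemma phi_W_conj n : conjv (phi_W n) = phi_W n.
Proof.
have c0 (V : realVect R) (v : V) : (rv_conj v == 0) = (v == 0).
  by rewrite -!memv0 -memv_conjv conjv0.
apply/vspaceP => -[[x y] z]; rewrite memv_conjv.
by rewrite memv_phi_W (c0 (tate_vect R 1)) c0 (c0 (tate_vect R 0)) -memv_phi_W.
Qed.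

Lemma phi_F_decr p q : p <= q -> (phi_F q <= phi_F p)%VS.
Proof.
rewrite le_eqVlt => /predU1P[->|pq]; first exact: subvv.
have sF v : v \in hs_F H q -> v \in hs_F H p.
  exact: (subvP (hs_F_decr H (ltW pq))).
apply/subvP => -[[x y] z]; rewrite !memv_phi_F.
have [q0|q0] := eqVneq q 0; have [p0|p0] := eqVneq p 0.
- by move: pq; rewrite q0 p0.
- rewrite q0 in pq sF; case/andP => _ /sF->.
  have -> : p <= -1 by lia.
  by rewrite (ltW pq).
- rewrite p0 in pq sF; case/and3P.
  have /negPf-> : ~~ (q <= -1) by lia.
  have /negPf-> : ~~ (q <= 0) by lia.
  by move=> /eqP-> /sF-> /eqP->; rewrite mul0r eqxx.
have mono (k : int) (b : bool) : (q <= k) || b -> (p <= k) || b.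
  by case: b; rewrite ?orbT // !orbF => qk; apply: le_trans (ltW pq) qk.
by case/and3P => /mono-> /sF-> /mono->.
Qed.

Lemma phi_F_exhaustive : exists p, phi_F p = fullv.
Proof.
have [p Fp] := hs_F_exhaustive H; exists (Num.min p (-1)).
apply/vspaceP => -[[x y] z]; rewrite memv_phi_F memvf.
have /negPf-> : Num.min p (-1) != 0 by lia.
have -> : Num.min p (-1) <= -1 by lia.
have -> : Num.min p (-1) <= 0 by lia.
have le_p : Num.min p (-1) <= p by lia.
by rewrite (subvP (hs_F_decr H le_p)) // Fp memvf.
Qed.

Lemma phi_F_separated : exists p, phi_F p = 0%VS.
Proof.
have [p Fp] := hs_F_separated H; exists (Num.max p 1).
apply/vspaceP => -[[x y] z]; rewrite memv_phi_F memv0 /=.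
have /negPf-> : Num.max p 1 != 0 by lia.
have /negPf-> : ~~ (Num.max p 1 <= -1) by lia.
have /negPf-> : ~~ (Num.max p 1 <= 0) by lia.
have le_p : p <= Num.max p 1 by lia.
apply/and3P/eqP => [[/eqP-> yF /eqP->]|[-> -> ->]]; last first.
  by split; rewrite ?eqxx //; apply: mem0v.
have := subvP (hs_F_decr H le_p) _ yF; rewrite Fp memv0 => /eqP->.
by [].
Qed.

Lemma phi_splits2 : splits_gr phi_W phi_F phi_pr2.
Proof.
split.
- by move=> [[x y] z]; rewrite !phi_pr2E.
- move=> [[x y] z]; rewrite phi_pr2E /= !memv_phi_W /=.
  by move=> /andP[/eqP-> /eqP->]; rewrite !eqxx !andbT.
- by move=> x; exists (x, 0, 0); rewrite ?phi_pr2E // memv_phi_W /= !eqxx.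
- move=> p [[x y] z]; rewrite phi_pr2E memv_cap memv_phi_F memv_phi_W /=.
  rewrite memv_tate_F; case: eqP => _ /and3P[+ _ /eqP z0]; rewrite z0.
    by rewrite mul0r => /andP[-> _]; rewrite orbT.
  by case/and3P.
move=> p x; rewrite memv_tate_F => xF; exists (x, 0, 0); last by rewrite phi_pr2E.
rewrite memv_cap memv_phi_F memv_phi_W /= !eqxx !mem0v mul0r orbT !andbT.
by case: eqP => [p0|_]; rewrite ?xF // p0 in xF *.
Qed.

Lemma phi_splits1 : splits_gr phi_W phi_F phi_pr1.
Proof.
split.
- by move=> [[x y] z]; rewrite !phi_pr1E.
- move=> [[x y] z]; rewrite phi_pr1E /= !memv_phi_W /=.
  by move=> /eqP->; rewrite eqxx !andbT.
- by move=> y; exists (0, y, 0); rewrite ?phi_pr1E // memv_phi_W /= !eqxx.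
- move=> p [[x y] z]; rewrite phi_pr1E memv_cap memv_phi_F memv_phi_W /=.
  by case: eqP => [->|_] /andP[+ _] => [/andP[]|/and3P[]].
move=> p y yF; exists (0, y, 0); last by rewrite phi_pr1E.
rewrite memv_cap memv_phi_F memv_phi_W /= !eqxx mul0r eqxx !orbT !andbT yF.
by case: eqP yF => // ->.
Qed.

Lemma phi_splits0 : splits_gr phi_W phi_F phi_pr0.
Proof.
split.
- by move=> [[x y] z]; rewrite !phi_pr0E.
- by move=> [[x y] z]; rewrite phi_pr0E /= !memv_phi_W.
- by move=> z; exists (0, 0, z); rewrite ?phi_pr0E // memv_phi_W.
- move=> p [[x y] z]; rewrite phi_pr0E memv_cap memv_phi_F memv_phi_W /=.
  by rewrite memv_tate_F; case: eqP => [->|_] // /andP[/and3P[]].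
move=> p z; rewrite memv_tate_F => zF; exists (z * c%:C, 0, z).
  rewrite memv_cap memv_phi_F memv_phi_W /= eqxx !mem0v andbT.
  case: eqP => // p0; rewrite zF andbT /=.
  case/orP: zF => [pz|/eqP->]; last by rewrite mul0r eqxx orbT.
  by have -> : p <= -1 by lia.
by rewrite phi_pr0E.
Qed.

Lemma phi_pure n p : let A := gr_F phi_W phi_F n in
  (A p + conjv (A (n + 1 - p)) = phi_W n)%VS /\
  (A p :&: conjv (A (n + 1 - p)) = phi_W (n - 1))%VS.
Proof.
have sW m : (phi_W (m - 1) <= phi_W m)%VS by apply: phi_W_incr; lia.
have [->|n2] := eqVneq n (-2).
  exact: (splits_gr_pure (sW _) phi_W_conj phi_splits2).
have [->|n1] := eqVneq n (-1).
  exact: (splits_gr_pure (sW _) phi_W_conj phi_splits1).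
have [->|n0] := eqVneq n 0.
  exact: (splits_gr_pure (sW _) phi_W_conj phi_splits0).
have WW : phi_W (n - 1) = phi_W n.
  rewrite /phi_W.
  have -> : (-2 <= n - 1) = (-2 <= n) by lia.
  have -> : (-1 <= n - 1) = (-1 <= n) by lia.
  by have -> : (0 <= n - 1) = (0 <= n) by lia.
have AW q : gr_F phi_W phi_F n q = phi_W n.
  by rewrite /gr_F WW; apply/addv_idPr; apply: capvSr.
by rewrite /= !AW WW phi_W_conj addvv capvv.
Qed.

Definition phi_mhs : realMHS R :=
  RealMHS phi_W_incr (ex_intro _ _ phi_W_top) (ex_intro _ _ phi_W_bot)
          phi_W_conj phi_F_decr phi_F_exhaustive phi_F_separated phi_pure.

Definition phi_grading : biext_grading phi_mhs H :=
  @BiextGrading R phi_mhs H phi_W_bot phi_W_top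
    (@split_gr_ident R phi_mhs _ (tate R 1) phi_pr2 phi_splits2)
    (@split_gr_ident R phi_mhs _ H phi_pr1 phi_splits1)
    (@split_gr_ident R phi_mhs _ (tate R 0) phi_pr0 phi_splits0).

Definition phi : realBiext H := RealBiext phi_grading.

End Phi.

Section HeightAndPeriods.
Variable R : realType.

(* The default value 0 plays no role: phi is a bijection from R to the
   isomorphism classes of real biextensions. *)
Definition height (H : intHS R (-1)) (B : biext H) : R :=
  xget 0 [set c | biext_isom (real_biext B) (phi H c)].

Definition is_basis (V : vectType R[i]) (U : {vspace V}) n (e : 'I_n -> V) :=
  basis_of U [tuple e i | i < n].

(* gamma^0, ..., gamma^(2k+1), indexed by 1 + (2k + 1). *)
Definition adapted_int_basis (H : intHS R (-1)) (B : biext H) k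
    (gamma : 'I_(1 + ((k + k) + 1)) -> be_mhs B) :=
  let G := be_grading B in
  let gamma0 := gamma (lshift _ ord0) in
  let gammaH j := gamma (rshift 1 (lshift 1 j)) in
  let gamma1 := gamma (rshift 1 (rshift (k + k) ord0)) in
  [/\ int_basis gamma (@imhs_lat R (be_mhs B)),
      gamma0 \in mhs_W (be_mhs B) (-2) /\
        gr_class (bg_gr2 G) gamma0 = (0 +i* (2 * pi)),
      (forall j, gammaH j \in mhs_W (be_mhs B) (-1)) /\
        int_basis (fun j => gr_class (bg_gr1 G) (gammaH j)) (@ihs_lat R _ H)
    & gr_class (bg_gr0 G) gamma1 = 1 ].

Definition adapted_F0_basis (H : intHS R (-1)) (B : biext H) k
    (omega : 'I_(k + 1) -> be_mhs B) :=
  let G := be_grading B in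
  let omegaH i := omega (lshift 1 i) in
  [/\ is_basis (mhs_F (be_mhs B) 0) omega,
      (forall i, omegaH i \in mhs_W (be_mhs B) (-1)) /\
        is_basis (hs_F H 0) (fun i => gr_class (bg_gr1 G) (omegaH i))
    & gr_class (bg_gr0 G) (omega (rshift k ord0)) = 1 ].

Definition is_period_matrix (H : intHS R (-1)) (B : biext H) k
    (P : 'M[R[i]]_(k + 1, 1 + ((k + k) + 1))) :=
  exists (gamma : 'I_(1 + ((k + k) + 1)) -> be_mhs B)
         (omega : 'I_(k + 1) -> be_mhs B),
    [/\ adapted_int_basis gamma, adapted_F0_basis omega
      & forall i, omega i = \sum_j P i j *: gamma j].

Definition Re_mx m n (A : 'M[R[i]]_(m, n)) : 'M[R]_(m, n) :=
  map_mx (@complex.Re R) A.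
Definition Im_mx m n (A : 'M[R[i]]_(m, n)) : 'M[R]_(m, n) :=
  map_mx (@complex.Im R) A.

End HeightAndPeriods.

(* Main.v *)
Require Import Defs.
From HB Require Import structures.
From mathcomp Require Import all_boot all_order all_algebra.
From mathcomp Require Import complex.
From mathcomp Require Import all_classical all_reals all_analysis.
From mathcomp Require Import zify.

Set Implicit Arguments.
Unset Strict Implicit.
Unset Printing Implicit Defensive.

Import Order.TTheory GRing.Theory Num.Theory.

Local Open Scope complex_scope.
Local Open Scope ring_scope.

(** The height is determined by one matching of period data.  An isomorphism f
    from the real biextension B to phi(h) is real, so on the basis gamma its
    R(1)-component takes values 2 pi i, 2 pi i x_j and 2 pi i x_0 with x_j and
    x_0 real, and its R(0)-component is the class in Gr_0.  Since f maps F^0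
    to F^0, the R(1)-component vanishes at omega_1, ..., omega_k and equals h
    at omega_(k+1).  Expanding the omega_i in the gamma^j, these conditions
    read
      b + P_H x = 0    and    h = 2 pi i (c + a x + x_0).
    The imaginary and real parts of the first equation form the real square
    system (Im P_H; Re P_H) x = - (Im b; Re b), whose matrix is invertible
    because H_C is the direct sum of F^0 H and its conjugate
    ([period_unitmx]).  So x is forced; the real part of the second equation
    is h = - 2 pi (Im c + Im a . x), which is the claimed formula, and its
    imaginary part fixes x_0 ([period_heightP]).

    Conversely, given x and x_0 solving these equations, prescribing f on gamma
    leaves free only the H-component of f(gamma^(2k+1)), a real vector y.
    It must be such that the H-component of f(omega_(k+1)), which is a + y in
    the basis of classes of the gamma^j, lies in F^0 H; invertibility of the
    same matrix provides y ([real_combination_complement]).  The resulting f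
    preserves W, F and the graded identifications, and such a morphism of
    biextensions is automatically an isomorphism
    ([morphism_biext_isom]).  Hence phi(h) is isomorphic to B exactly for
    h given by the formula ([isom_phiP]). *)

(** * Real and imaginary parts of complex matrices *)

Section RealAndImaginaryParts.
Variable R : realType.

Definition complex_mx m n (A : 'M[R]_(m, n)) : 'M[R[i]]_(m, n) :=
  map_mx (real_complex R) A.

Lemma complex_mx_ReK m n (A : 'M[R]_(m, n)) : Re_mx (complex_mx A) = A.
Proof. by apply/matrixP => i j; rewrite !mxE. Qed.

Lemma complex_mx_Im0 m n (A : 'M[R]_(m, n)) : Im_mx (complex_mx A) = 0.
Proof. by apply/matrixP => i j; rewrite !mxE. Qed.

Lemma Re_mxD m n (A B : 'M[R[i]]_(m, n)) : Re_mx (A + B) = Re_mx A + Re_mx B.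
Proof.
by apply/matrixP => i j; rewrite !mxE; case: (A i j) (B i j) => ? ? [].
Qed.

Lemma Im_mxD m n (A B : 'M[R[i]]_(m, n)) : Im_mx (A + B) = Im_mx A + Im_mx B.
Proof.
by apply/matrixP => i j; rewrite !mxE; case: (A i j) (B i j) => ? ? [].
Qed.

Lemma Re_mx_mul m n p (A : 'M[R[i]]_(m, n)) (B : 'M[R[i]]_(n, p)) :
  Re_mx (A *m B) = Re_mx A *m Re_mx B - Im_mx A *m Im_mx B.
Proof.
apply/matrixP => i j; rewrite !mxE.
rewrite (big_morph (@complex.Re R) (id1 := 0) (op1 := +%R)) //;
  last by case=> ? ? [].
rewrite -sumrB; apply: eq_bigr => l _; rewrite !mxE.
by case: (A i l) (B l j) => ? ? [].
Qed.

Lemma Im_mx_mul m n p (A : 'M[R[i]]_(m, n)) (B : 'M[R[i]]_(n, p)) :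
  Im_mx (A *m B) = Re_mx A *m Im_mx B + Im_mx A *m Re_mx B.
Proof.
apply/matrixP => i j; rewrite !mxE.
rewrite (big_morph (@complex.Im R) (id1 := 0) (op1 := +%R)) //;
  last by case=> ? ? [].
rewrite -big_split; apply: eq_bigr => l _; rewrite !mxE.
by case: (A i l) (B l j) => ? ? [].
Qed.

Lemma Re_Im_mx_inj m n (A B : 'M[R[i]]_(m, n)) :
  Re_mx A = Re_mx B -> Im_mx A = Im_mx B -> A = B.
Proof.
move=> /matrixP reAB /matrixP imAB; apply/matrixP => i j; apply/eqP.
have := reAB i j; have := imAB i j; rewrite !mxE eq_complex => -> ->.
by rewrite !eqxx.
Qed.

Lemma Im_Re_col_mx_mul m n p (P : 'M[R[i]]_(m, n)) (x : 'M[R]_(n, p)) :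
  col_mx (Im_mx P) (Re_mx P) *m x =
  col_mx (Im_mx (P *m complex_mx x)) (Re_mx (P *m complex_mx x)).
Proof.
by rewrite mul_col_mx Im_mx_mul Re_mx_mul complex_mx_ReK complex_mx_Im0
  !mulmx0 subr0 add0r.
Qed.

Lemma Re_complex_mxDi m n (u v : 'M[R]_(m, n)) :
  Re_mx (complex_mx u + 'i *: complex_mx v) = u.
Proof. by apply/matrixP => i j; rewrite !mxE /= !mul0r mul1r subr0 addr0. Qed.

Lemma Im_complex_mxDi m n (u v : 'M[R]_(m, n)) :
  Im_mx (complex_mx u + 'i *: complex_mx v) = v.
Proof. by apply/matrixP => i j; rewrite !mxE /= !mul0r mul1r !add0r. Qed.

(** A row of the stacked real matrix is a complex row in disguise: its left
    half is the real part and its right half the imaginary part, which is why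
    the imaginary part of P is stacked on top. *)
Lemma Im_mx_row_mul m k n (u v : 'M[R]_(m, k)) (P : 'M[R[i]]_(k, n)) :
  row_mx u v *m col_mx (Im_mx P) (Re_mx P) =
  Im_mx ((complex_mx u + 'i *: complex_mx v) *m P).
Proof.
by rewrite mul_row_col Im_mx_mul Re_complex_mxDi Im_complex_mxDi.
Qed.

Lemma unitmx_Im_Re k (P : 'M[R[i]]_(k, k + k)) :
  (forall d : 'rV[R[i]]_k, Im_mx (d *m P) = 0 -> d = 0) ->
  col_mx (Im_mx P) (Re_mx P) \in unitmx.
Proof.
move=> injP; rewrite -row_free_unit; apply: inj_row_free => w.
rewrite -[w]hsubmxK Im_mx_row_mul => /injP d0.
have re0 := Re_complex_mxDi (lsubmx w) (rsubmx w).
have im0 := Im_complex_mxDi (lsubmx w) (rsubmx w).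
rewrite d0 in re0 im0; rewrite -re0 -im0.
by apply/rowP => i; rewrite !mxE; case: fintype.splitP => l _; rewrite !mxE.
Qed.

(** Modulo the complex row space of P every vector is real, since the
    imaginary part of a can be matched by that of some d *m P. *)
Lemma real_combination_complement k (P : 'M[R[i]]_(k, k + k))
    (a : 'rV[R[i]]_(k + k)) :
  col_mx (Im_mx P) (Re_mx P) \in unitmx ->
  exists (y : 'rV[R]_(k + k)) (d : 'rV[R[i]]_k), a + complex_mx y = d *m P.
Proof.
move=> uM; pose w := Im_mx a *m invmx (col_mx (Im_mx P) (Re_mx P)).
pose d := complex_mx (lsubmx w) + 'i *: complex_mx (rsubmx w).
exists (Re_mx (d *m P) - Re_mx a), d; apply: Re_Im_mx_inj.
  by rewrite Re_mxD complex_mx_ReK addrC subrK.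
by rewrite Im_mxD complex_mx_Im0 addr0 -Im_mx_row_mul hsubmxK mulmxKV.
Qed.

(** The first equation on the right, split into real and imaginary parts, has
    the solution x = - M^-1 (Im b; Re b) only.  In the second one x0 absorbs
    the real part of c + a x, and multiplication by 2 pi i turns its imaginary
    part into h. *)
Lemma period_heightP k (b : 'cV[R[i]]_k) (P : 'M[R[i]]_(k, k + k))
    (a : 'rV[R[i]]_(k + k)) (c : R[i]) (h : R) :
  col_mx (Im_mx P) (Re_mx P) \in unitmx ->
  h = - (2 * pi) * (complex.Im c
         - (Im_mx a *m invmx (col_mx (Im_mx P) (Re_mx P))
            *m col_mx (Im_mx b) (Re_mx b)) ord0 ord0) <->
  exists (x : 'cV[R]_(k + k)) (x0 : R), b + P *m complex_mx x = 0 /\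
    h%:C = tate_gen R 1 * (c + (a *m complex_mx x) ord0 ord0 + x0%:C).
Proof.
move=> uM; set M := col_mx _ _ in uM *; set beta := col_mx (Im_mx b) _.
have heqE (x : 'cV[R]_(k + k)) (x0 : R) :
    (h%:C = tate_gen R 1 * (c + (a *m complex_mx x) ord0 ord0 + x0%:C)) <->
    h = - (2 * pi) * (complex.Im c + (Im_mx a *m x) ord0 ord0) /\
    x0 = - (complex.Re c + (Re_mx a *m x) ord0 ord0).
  have -> : Re_mx a *m x = Re_mx (a *m complex_mx x).
    by rewrite Re_mx_mul complex_mx_ReK complex_mx_Im0 mulmx0 subr0.
  have -> : Im_mx a *m x = Im_mx (a *m complex_mx x).
    by rewrite Im_mx_mul complex_mx_ReK complex_mx_Im0 mulmx0 add0r.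
  rewrite [Re_mx _ _ _]mxE [Im_mx _ _ _]mxE.
  case: ((a *m _) ord0 ord0) => s t.
  have pi2 : (2 * pi : R) != 0 by rewrite mulf_neq0 ?pnatr_eq0 ?gt_eqF ?pi_gt0.
  rewrite /tate_gen expr1 /real_complex_def; case: c => c1 c2 /=; split.
    case; rewrite !mul0r add0r add0r addr0 => -> /esym/eqP.
    rewrite mulf_eq0 (negPf pi2) /= addr_eq0 => /eqP ->.
    by rewrite opprK mulNr.
  case=> -> ->; apply/eqP; rewrite eq_complex /=.
  by rewrite !mul0r add0r addr0 subrr mulr0 mulNr add0r !eqxx.
have xE (x : 'cV[R]_(k + k)) :
    (b + P *m complex_mx x = 0) <-> x = - (invmx M *m beta).
  have -> : (x = - (invmx M *m beta)) <-> M *m x = - beta.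
    split=> [->|/(congr1 (mulmx (invmx M)))]; first by rewrite mulmxN mulKVmx.
    by rewrite mulKmx // mulmxN.
  rewrite Im_Re_col_mx_mul /beta opp_col_mx; split => [|/eq_col_mx[im re]].
    move/eqP; rewrite addrC addr_eq0 => /eqP->.
    by congr col_mx; apply/matrixP => i j; rewrite !mxE; case: (b i j).
  apply: Re_Im_mx_inj.
    by rewrite Re_mxD re subrr; apply/matrixP => i j; rewrite !mxE.
  by rewrite Im_mxD im subrr; apply/matrixP => i j; rewrite !mxE.
have formE : (Im_mx a *m - (invmx M *m beta)) ord0 ord0 =
    - (Im_mx a *m invmx M *m beta) ord0 ord0.
  by rewrite mulmxN mulmxA mxE.
split=> [hE|[x [x0 [/xE -> /heqE[-> _]]]]]; last by rewrite formE.
exists (- (invmx M *m beta)).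
exists (- (complex.Re c + (Re_mx a *m - (invmx M *m beta)) ord0 ord0)).
by split; [apply/xE | apply/heqE; rewrite formE hE].
Qed.
End RealAndImaginaryParts.

(** * Classes in graded pieces *)

Section GradedClasses.
Variable R : realType.

Section OneWeight.
Variables (M : realMHS R) (n : int) (H : realHS R n) (g : gr_ident M H).
Local Notation W := (mhs_W M).

Lemma gr_class_linear : linear (gr_class g).
Proof. by move=> a u v; rewrite /gr_class !linearP. Qed.

HB.instance Definition _ :=
  GRing.isLinear.Build R[i] M H *:%R (gr_class g) gr_class_linear.

Lemma gr_class_eq0 v : v \in W n -> (gr_class g v == 0) = (v \in W (n - 1)).
Proof.
by move=> vW; rewrite /gr_class -memv_ker gr_ker -memv_preim lfunE /= vsprojK.
Qed.

Lemma gr_class_F p v :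
  v \in W n -> v \in mhs_F M p -> gr_class g v \in hs_F H p.
Proof.
move=> vW vF; rewrite -(gr_mapF g); apply: memv_img.
by rewrite -memv_preim lfunE /= vsprojK.
Qed.

Lemma gr_class_F_lift p x : x \in hs_F H p ->
  exists v, [/\ v \in W n, v \in mhs_F M p & gr_class g v = x].
Proof.
rewrite -(gr_mapF g) => /memv_imgP[w]; rewrite -memv_preim lfunE /= => wF ->.
by exists (vsval w); rewrite subvsP wF /gr_class vsvalK.
Qed.

End OneWeight.

Lemma gr_class_split (M : realMHS R) n (H : realHS R n) (g : 'Hom(M, H))
    (sg : splits_gr (mhs_W M) (mhs_F M) g) v :
  v \in mhs_W M n -> gr_class (split_gr_ident sg) v = g v.
Proof. by move=> vW; rewrite /gr_class /= comp_lfunE lfunE /= vsprojK. Qed.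

End GradedClasses.

(** * Morphisms of biextensions are isomorphisms *)

Section MorphismsOfBiextensions.
Variables (R : realType) (H : realHS R (-1)) (X Y : realBiext H).
Variable f : 'Hom(X, Y).

Lemma mhs_W_below (Z : realBiext H) n : n <= -3 -> mhs_W Z n = 0%VS.
Proof.
move=> n3; apply/eqP; rewrite -subv0 -(bg_W_bot (rb_grading Z)).
exact: mhs_W_incr.
Qed.

Lemma mhs_W_above (Z : realBiext H) n : 0 <= n -> mhs_W Z n = fullv.
Proof.
move=> n0; apply/eqP; rewrite eqEsubv subvf -(bg_W_top (rb_grading Z)).
exact: mhs_W_incr.
Qed.

Hypothesis fW : forall n v, v \in mhs_W X n -> f v \in mhs_W Y n.
Hypothesis fF : forall p v, v \in mhs_F X p -> f v \in mhs_F Y p.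
Hypothesis f2 :
  gr_compat f (bg_gr2 (rb_grading X)) (bg_gr2 (rb_grading Y)).
Hypothesis f1 :
  gr_compat f (bg_gr1 (rb_grading X)) (bg_gr1 (rb_grading Y)).
Hypothesis f0 :
  gr_compat f (bg_gr0 (rb_grading X)) (bg_gr0 (rb_grading Y)).

(** Strictness for W: as f is the identity on each graded piece, the class of
    v in Gr_m vanishes as soon as f v lies in W_(m-1), so v descends through
    the weights together with f v. *)
Lemma morphism_mem_W n v : f v \in mhs_W Y n -> v \in mhs_W X n.
Proof.
have down m (G : realHS R m) (gX : gr_ident X G) (gY : gr_ident Y G) :
    gr_compat f gX gY -> v \in mhs_W X m -> f v \in mhs_W Y (m - 1) ->
    v \in mhs_W X (m - 1).
  move=> fg vW fvW; rewrite -(gr_class_eq0 gX vW) -fg //.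
  by rewrite gr_class_eq0 // fW.
move=> fvW; have up m : n <= m -> f v \in mhs_W Y m.
  by move=> nm; apply: subvP fvW; apply: mhs_W_incr.
have [n0|n0] := lerP 0 n; first by rewrite mhs_W_above ?memvf.
have v1 : v \in mhs_W X (-1).
  apply: (down _ _ _ _ f0); last by apply: up; lia.
  by rewrite mhs_W_above ?memvf.
have [n1|n1] := lerP (-1) n; first by have -> : n = -1 by lia.
have v2 : v \in mhs_W X (-2) by apply: (down _ _ _ _ f1) => //; apply: up; lia.
have [n2|n2] := lerP (-2) n; first by have -> : n = -2 by lia.
have : v \in mhs_W X (-3) by apply: (down _ _ _ _ f2) => //; apply: up; lia.
by rewrite mhs_W_below // memv0 => /eqP->; apply: mem0v.
Qed.

Lemma morphism_inj : lker f = 0%VS.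
Proof.
apply/eqP; rewrite -subv0; apply/subvP => v; rewrite memv_ker => /eqP fv0.
by rewrite -(@mhs_W_below X (-3)) // morphism_mem_W // fv0 mem0v.
Qed.

(** Climbing through the weights: an element of F^p in weight m is corrected by
    the image of an element of F^p with the same class in Gr_m, which exists
    because both sides induce the same Hodge filtration on Gr_m. *)
Lemma morphism_mapF p : (f @: mhs_F X p)%VS = mhs_F Y p.
Proof.
have up m (G : realHS R m) (gX : gr_ident X G) (gY : gr_ident Y G) :
    gr_compat f gX gY ->
    (mhs_F Y p :&: mhs_W Y (m - 1) <= f @: mhs_F X p)%VS ->
    (mhs_F Y p :&: mhs_W Y m <= f @: mhs_F X p)%VS.
  move=> fg /subvP below; apply/subvP => y; rewrite memv_cap => /andP[yF yW].
  have [x [xW xF xy]] := gr_class_F_lift gX (gr_class_F gY yW yF).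
  rewrite -(subrK (f x) y) rpredD ?memv_img //; apply: below.
  rewrite memv_cap rpredB ?fF //= -(gr_class_eq0 gY) ?rpredB ?fW //.
  by rewrite linearB /= fg // xy subrr.
apply/eqP; rewrite eqEsubv; apply/andP; split.
  by apply/subvP => _ /memv_imgP[x xF ->]; apply: fF.
rewrite -[mhs_F Y p]capvf -(@mhs_W_above Y 0) //.
apply: (up _ _ _ _ f0); apply: (up _ _ _ _ f1); apply: (up _ _ _ _ f2).
by rewrite mhs_W_below // capv0 sub0v.
Qed.

Lemma morphism_surj : limg f = fullv.
Proof.
have [p Fp] := mhs_F_exhaustive Y; apply/eqP; rewrite eqEsubv subvf /=.
by rewrite -Fp -morphism_mapF limgS ?subvf.
Qed.

Lemma morphism_mapW n : (f @: mhs_W X n)%VS = mhs_W Y n.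
Proof.
apply/vspaceP => y; apply/memv_imgP/idP => [[x xW ->]|yW]; first exact: fW.
have /memv_imgP[x _ yfx] : y \in limg f by rewrite morphism_surj memvf.
by exists x; rewrite // morphism_mem_W // -yfx.
Qed.

Lemma morphism_biext_isom :
  (forall v, f (rv_conj v) = rv_conj (f v)) -> biext_isom X Y.
Proof.
move=> fc; exists f; split => //.
- by split; [exact: morphism_inj | exact: morphism_surj].
- exact: morphism_mapW.
exact: morphism_mapF.
Qed.

End MorphismsOfBiextensions.

(** * Bases and lattices *)

Section Bases.
Variable R : realType.

Lemma basis_extend (V U : vectType R[i]) n (e : 'I_n -> V) (u : 'I_n -> U) :
  is_basis fullv e -> exists f : 'Hom(V, U), forall i, f (e i) = u i.
Proof.
move=> /basis_free free_e.
have [f fe] := linear_of_free [tuple e i | i < n] (map u (enum 'I_n)).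
exists (linfun f) => i; rewrite lfunE /=.
have {fe} := fe free_e; rewrite /= !size_map -map_comp => /(_ erefl).
by move/eq_in_map => /(_ i); apply; rewrite mem_enum.
Qed.

Lemma is_basis_sum (V : vectType R[i]) (U : {vspace V}) n (e : 'I_n -> V) v :
  is_basis U e -> v \in U -> exists z : 'I_n -> R[i], v = \sum_i z i *: e i.
Proof.
move=> be vU; exists (fun i => coord [tuple e i | i < n] i v).
rewrite {1}(coord_basis be vU); apply: eq_bigr => i _.
by rewrite -tnth_nth tnth_mktuple.
Qed.

Lemma is_basis_free (V : vectType R[i]) (U : {vspace V}) n (e : 'I_n -> V)
    (z : 'I_n -> R[i]) :
  is_basis U e -> \sum_i z i *: e i = 0 -> forall i, z i = 0.
Proof.
move=> /basis_free /freeP free_e ze0; apply: free_e; rewrite -[RHS]ze0.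
by apply: eq_bigr => i _; rewrite -tnth_nth tnth_mktuple.
Qed.

Lemma is_basis_mem (V : vectType R[i]) (U : {vspace V}) n (e : 'I_n -> V) i :
  is_basis U e -> e i \in U.
Proof.
move=> be; apply: (basis_mem be).
by apply: map_f; rewrite mem_enum.
Qed.

Lemma int_span_gen (V : vectType R[i]) n (e : 'I_n -> V) i : int_span e (e i).
Proof.
exists (fun j => (j == i)%:Z); rewrite (bigD1 i) //= eqxx scale1r.
rewrite big1 ?addr0 //.
by move=> j /negPf->; rewrite scale0r.
Qed.

Lemma span_int_basis (V : realVect R) (L : set V) n (e : 'I_n -> V) :
  is_lattice L -> int_basis e L -> <<[tuple e i | i < n]>>%VS = fullv.
Proof.
move=> [[m [e' [be' Le']]] _] [Le _]; apply/eqP; rewrite eqEsubv subvf /=.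
rewrite -(span_basis be'); apply/span_subvP => _ /tnthP[i ->].
have : L (tnth e' i) by rewrite Le'; apply: int_span_gen.
rewrite Le => -[z ->]; apply: memv_suml => j _; apply/memvZ/memv_span.
by apply: map_f; rewrite mem_enum.
Qed.

(** Real points of R(m) are the real multiples of (2 pi i)^m. *)
Lemma tate_conj_fixed m (z : R[i]) :
  tate_conj m z = z -> exists r : R, z = tate_gen R m * r%:C.
Proof.
rewrite /tate_conj => zE; exists (complex.Re (z / tate_gen R m)).
have gz : z / tate_gen R m = conjc (z / tate_gen R m).
  by rewrite -{1}zE [LHS]mulrC mulKf ?tate_gen_neq0.
rewrite {1}(_ : z = tate_gen R m * (z / tate_gen R m)); last first.
  by rewrite mulrC divfK ?tate_gen_neq0.
congr (_ * _); case: (z / _) gz => s t [] /eqP.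
rewrite eq_sym -subr_eq0 -opprD oppr_eq0 -mulr2n mulrn_eq0 /= => /eqP->.
by [].
Qed.

End Bases.

(** * The period matrix of a biextension *)

Section PeriodMatrix.
Variables (R : realType) (H : intHS R (-1)) (B : biext H) (k : nat).
Variables (gamma : 'I_(1 + ((k + k) + 1)) -> be_mhs B).
Variables (omega : 'I_(k + 1) -> be_mhs B).
Variable P : 'M[R[i]]_(k + 1, 1 + ((k + k) + 1)).
Hypothesis rkH : \dim {: H} = (k + k)%N.
Hypothesis gammaP : adapted_int_basis gamma.
Hypothesis omegaP : adapted_F0_basis omega.
Hypothesis PE : forall i, omega i = \sum_j P i j *: gamma j.

Local Notation W := (mhs_W (be_mhs B)).
Local Notation F := (mhs_F (be_mhs B)).
Local Notation cl2 := (gr_class (bg_gr2 (be_grading B))).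
Local Notation cl1 := (gr_class (bg_gr1 (be_grading B))).
Local Notation cl0 := (gr_class (bg_gr0 (be_grading B))).
Local Notation g0 := (gamma (lshift _ ord0)).
Local Notation gH j := (gamma (rshift 1 (lshift 1 j))).
Local Notation g1 := (gamma (rshift 1 (rshift (k + k) ord0))).
Local Notation wH i := (omega (lshift 1 i)).
Local Notation w1 := (omega (rshift k ord0)).
Local Notation b := (ulsubmx P).
Local Notation PH := (lsubmx (ursubmx P)).
Local Notation a := (lsubmx (drsubmx P)).
Local Notation c := (P (rshift k ord0) (lshift _ ord0)).

Lemma sum_gamma (V : lmodType R[i]) (z : 'I_(1 + ((k + k) + 1)) -> R[i])
    (v : 'I_(1 + ((k + k) + 1)) -> V) :
  \sum_j z j *: v j =
  z (lshift _ ord0) *: v (lshift _ ord0)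
  + \sum_j z (rshift 1 (lshift 1 j)) *: v (rshift 1 (lshift 1 j))
  + z (rshift 1 (rshift (k + k) ord0)) *: v (rshift 1 (rshift (k + k) ord0)).
Proof. by rewrite big_split_ord big_split_ord /= !big_ord1 addrA. Qed.

Lemma W0_full v : v \in W 0.
Proof. by rewrite (bg_W_top (be_grading B)) memvf. Qed.

Lemma g0_W : g0 \in W (-2). Proof. by case: gammaP => _ []. Qed.

Lemma gH_W j : gH j \in W (-1). Proof. by case: gammaP => _ _ []. Qed.

Lemma g0_W1 : g0 \in W (-1).
Proof. by apply: subvP g0_W; apply: mhs_W_incr. Qed.

Lemma wH_W i : wH i \in W (-1). Proof. by case: omegaP => _ []. Qed.

Lemma cl0_W1 v : (cl0 v == 0) = (v \in W (-1)).
Proof. by rewrite gr_class_eq0 ?W0_full. Qed.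

Lemma cl1_W2 v : v \in W (-1) -> (cl1 v == 0) = (v \in W (-2)).
Proof. exact: gr_class_eq0. Qed.

Lemma cl0_sum z : cl0 (\sum_j z j *: gamma j) =
  z (rshift 1 (rshift (k + k) ord0)).
Proof.
have cl0g1 : cl0 g1 = 1 by case: gammaP.
have /eqP g00 : cl0 g0 == 0 by rewrite cl0_W1 g0_W1.
have gH0 j : cl0 (gH j) = 0 by apply/eqP; rewrite cl0_W1 gH_W.
rewrite sum_gamma !linearD linear_sum !linearZ /= cl0g1 g00 scaler0 add0r.
rewrite big1 ?add0r => [|j _]; first exact: mulr1.
by rewrite linearZ /= gH0 scaler0.
Qed.

Lemma cl1_gH_basis : is_basis fullv (fun j => cl1 (gH j)).
Proof.
have [_ _ [_ clH] _] := gammaP.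
by rewrite /is_basis basisEdim size_tuple rkH leqnn andbT
  (span_int_basis (ihs_latP H) clH).
Qed.

Lemma gamma_sum v : exists z : 'I_(1 + ((k + k) + 1)) -> R[i],
  v = \sum_j z j *: gamma j.
Proof.
have [gB _ _ _] := gammaP.
have spg := span_int_basis (imhs_latP (be_mhs B)) gB.
have /coord_span vE : v \in <<[tuple gamma j | j < _]>>%VS by rewrite spg memvf.
exists (fun j => coord [tuple gamma j | j < _] j v); rewrite {1}vE.
by apply: eq_bigr => j _; rewrite -tnth_nth tnth_mktuple.
Qed.

Lemma W1_sum v : v \in W (-1) ->
  exists z0 (z : 'I_(k + k) -> R[i]), v = z0 *: g0 + \sum_j z j *: gH j.
Proof.
have [z ->] := gamma_sum v; rewrite -cl0_W1 cl0_sum => /eqP z10.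
exists (z (lshift _ ord0)), (fun j => z (rshift 1 (lshift 1 j))).
by rewrite sum_gamma z10 scale0r addr0.
Qed.

Lemma cl1_W1_sum z0 (z : 'I_(k + k) -> R[i]) :
  cl1 (z0 *: g0 + \sum_j z j *: gH j) = \sum_j z j *: cl1 (gH j).
Proof.
have /eqP g00 : cl1 g0 == 0 by rewrite cl1_W2 ?g0_W ?g0_W1.
rewrite linearD linearZ /= g00 scaler0 add0r linear_sum.
by apply: eq_bigr => j _; rewrite linearZ.
Qed.

(** The coordinates along the gH j vanish because the classes of the gH j form
    a basis of H: they are as many as the dimension of H and span it. *)
Lemma W2_sum v : v \in W (-2) -> exists z0, v = z0 *: g0.
Proof.
move=> v2; have v1 : v \in W (-1) by apply: subvP v2; apply: mhs_W_incr.
have [z0 [z vE]] := W1_sum v1; move: v2; rewrite -(cl1_W2 v1) vE cl1_W1_sum.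
move=> /eqP /(is_basis_free cl1_gH_basis) z0E; exists z0.
by rewrite big1 ?addr0 // => j _; rewrite z0E scale0r.
Qed.

Lemma cl2_g0 : cl2 g0 = tate_gen R 1.
Proof. by case: gammaP => _ [_ ->]. Qed.

(** Freeness over the complex numbers is read off the graded pieces, from the
    top weight down. *)
Lemma gamma_basis : is_basis fullv gamma.
Proof.
have [gB _ _ _] := gammaP.
apply/andP; split.
  by rewrite (span_int_basis (imhs_latP (be_mhs B)) gB).
apply/freeP => z; under eq_bigr do rewrite -tnth_nth tnth_mktuple.
move=> zg0; have z1 : z (rshift 1 (rshift (k + k) ord0)) = 0.
  by rewrite -cl0_sum zg0 linear0.
move: zg0; rewrite sum_gamma z1 scale0r addr0 => zg0.
have zH j : z (rshift 1 (lshift 1 j)) = 0.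
  have := congr1 cl1 zg0; rewrite (cl1_W1_sum _ (fun l => z _)) linear0.
  by move/(is_basis_free cl1_gH_basis)/(_ j).
move: zg0; rewrite big1 ?addr0 => [|j _]; last by rewrite zH scale0r.
move/(congr1 cl2)/eqP; rewrite linearZ linear0 /= cl2_g0.
rewrite scaler_eq0 (negPf (tate_gen_neq0 R 1)) orbF => /eqP z0 j.
have [l ->|l ->] := split_ordP j; first by rewrite ord1.
have [l' ->|l' ->] := split_ordP l; first exact: zH.
by rewrite ord1.
Qed.

Lemma period_wH_last i :
  P (lshift 1 i) (rshift 1 (rshift (k + k) ord0)) = 0.
Proof. by rewrite -cl0_sum -PE; apply/eqP; rewrite cl0_W1 wH_W. Qed.

Lemma period_w1_last :
  P (rshift k ord0) (rshift 1 (rshift (k + k) ord0)) = 1.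
Proof. by rewrite -cl0_sum -PE; case: omegaP. Qed.

Lemma period_block :
  P = block_mx b (row_mx PH 0) c%:M (row_mx a 1%:M).
Proof.
rewrite -[LHS]submxK -{1}[ursubmx P]hsubmxK -{1}[drsubmx P]hsubmxK.
congr (block_mx _ (row_mx _ _) _ (row_mx _ _)); apply/matrixP => i j.
- by rewrite !mxE (ord1 j) period_wH_last.
- by rewrite !mxE (ord1 i) (ord1 j) mulr1n.
- by rewrite !mxE (ord1 i) (ord1 j) period_w1_last.
Qed.

Lemma wH_image (V : vectType R[i]) (L : 'Hom(be_mhs B, V)) i :
  L (wH i) = b i ord0 *: L g0 + \sum_j PH i j *: L (gH j).
Proof.
rewrite PE linear_sum; under eq_bigr do rewrite linearZ /=.
rewrite sum_gamma period_wH_last scale0r addr0 !mxE; congr (_ + _).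
by apply: eq_bigr => j _; rewrite !mxE.
Qed.

Lemma w1_image (V : vectType R[i]) (L : 'Hom(be_mhs B, V)) :
  L w1 = c *: L g0 + \sum_j a ord0 j *: L (gH j) + L g1.
Proof.
rewrite PE linear_sum; under eq_bigr do rewrite linearZ /=.
rewrite sum_gamma period_w1_last scale1r; congr (_ + _ + _).
by apply: eq_bigr => j _; rewrite !mxE.
Qed.

Lemma cl1_wH i : cl1 (wH i) = \sum_j PH i j *: cl1 (gH j).
Proof.
rewrite -(cl1_W1_sum (b i ord0)); congr (cl1 _).
have := wH_image \1%VF i; rewrite !id_lfunE => ->.
by congr (_ + _); apply: eq_bigr => j _; rewrite id_lfunE.
Qed.

Lemma sum_cl1_wH (d : 'rV[R[i]]_k) :
  \sum_i d ord0 i *: cl1 (wH i) = \sum_j (d *m PH) ord0 j *: cl1 (gH j).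
Proof.
under eq_bigr do rewrite cl1_wH scaler_sumr.
rewrite exchange_big; apply: eq_bigr => j _; rewrite mxE scaler_suml.
by apply: eq_bigr => i _; rewrite scalerA.
Qed.

Lemma cl1_gH_real j : rv_conj (cl1 (gH j)) = cl1 (gH j).
Proof.
have [_ _ [_ [HE _]] _] := gammaP; have [_ real_lat] := ihs_latP H.
by apply: real_lat; rewrite HE; apply: int_span_gen.
Qed.

Lemma gamma_real j : rv_conj (gamma j) = gamma j.
Proof.
have [[BE _] _ _ _] := gammaP; have [_ real_lat] := imhs_latP (be_mhs B).
by apply: real_lat; rewrite BE; apply: int_span_gen.
Qed.

Lemma cl1_wH_basis : is_basis (hs_F H 0) (fun i => cl1 (wH i)).
Proof. by case: omegaP => _ []. Qed.

(** If d *m PH is real, then the sum of the d_i times the classes of the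
    omega_i is a real vector of F^0 H, hence lies in the intersection of F^0 H
    with its conjugate, which is zero in weight -1. *)
Lemma period_unitmx : col_mx (Im_mx PH) (Re_mx PH) \in unitmx.
Proof.
apply: unitmx_Im_Re => d imd0; pose u := \sum_i d ord0 i *: cl1 (wH i).
have uF : u \in hs_F H 0.
  by apply: memv_suml => i _; apply/memvZ/(is_basis_mem _ cl1_wH_basis).
have u_real : rv_conj u = u.
  rewrite /u sum_cl1_wH rv_conj_sum; apply: eq_bigr => j _.
  rewrite cl1_gH_real; congr (_ *: _).
  have /matrixP/(_ ord0 j) := imd0; rewrite [LHS]mxE [RHS]mxE.
  by case: ((d *m PH) ord0 j) => s t /= ->; rewrite oppr0.
have [_ oI] := hs_opposed H 0.
have : u \in (hs_F H 0 :&: conjv (hs_F H (-1 + 1 - 0)))%VS.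
  by rewrite memv_cap memv_conjv u_real addNr subr0 uF.
rewrite oI memv0 => /eqP /(is_basis_free cl1_wH_basis) d0.
by apply/rowP => i; rewrite d0 mxE.
Qed.

(** * Isomorphisms onto phi *)

Section TargetPhi.
Variable h : R.

Local Notation BR := (real_biext B).
Local Notation Y := (phi H h).

Lemma phi_class2 (v : phi_vect H) : v \in phi_W H (-2) ->
  gr_class (bg_gr2 (rb_grading Y)) v = v.1.1.
Proof. by move=> vW; rewrite [LHS]gr_class_split // phi_pr2E. Qed.

Lemma phi_class1 (v : phi_vect H) : v \in phi_W H (-1) ->
  gr_class (bg_gr1 (rb_grading Y)) v = v.1.2.
Proof. by move=> vW; rewrite [LHS]gr_class_split // phi_pr1E. Qed.

Lemma phi_class0 (v : phi_vect H) :
  gr_class (bg_gr0 (rb_grading Y)) v = v.2.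
Proof.
rewrite [LHS]gr_class_split ?phi_pr0E //.
by rewrite -[mhs_W _ _]/(phi_W H 0) phi_W_top memvf.
Qed.

(** The entries of x and x0 are the R(1)-components of f (gH j) and f g1,
    divided by 2 pi i; they are real because the gamma and f are. *)
Lemma isom_phi_equations : biext_isom BR Y ->
  exists (x : 'cV[R]_(k + k)) (x0 : R), b + PH *m complex_mx x = 0 /\
    h%:C = tate_gen R 1 * (c + (a *m complex_mx x) ord0 ord0 + x0%:C).
Proof.
case=> f [_ fc fW fF [f2 _ f0]].
have fWm n v : v \in W n -> f v \in phi_W H n.
  by move=> vW; rewrite -[phi_W H n]/(mhs_W Y n) -fW memv_img.
have fFm p v : v \in F p -> f v \in phi_F H h p.
  by move=> vF; rewrite -[phi_F H h p]/(mhs_F Y p) -fF memv_img.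
pose l := (phi_pr2 H \o f)%VF.
have lE v : l v = (f v).1.1 by rewrite comp_lfunE phi_pr2E.
have fv2 v : (f v).2 = cl0 v.
  by rewrite -[RHS](f0 v (W0_full v)) phi_class0.
have lg0 : l g0 = tate_gen R 1.
  by rewrite lE -cl2_g0 -[RHS](f2 _ g0_W) phi_class2 // fWm ?g0_W.
have l_real j : exists r : R, l (gamma j) = tate_gen R 1 * r%:C.
  by apply: tate_conj_fixed; rewrite lE -{2}gamma_real fc.
have [x xE] : exists x : 'cV[R]_(k + k),
    forall j, l (gH j) = tate_gen R 1 * (x j ord0)%:C.
  have [r rE] := fin_all_exists (fun j => l_real (rshift 1 (lshift 1 j))).
  by exists (\col_j r j) => j; rewrite mxE.
have [x0 x0E] := l_real (rshift 1 (rshift (k + k) ord0)).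
exists x, x0; split.
  apply/colP => i; have : f (wH i) \in phi_F H h 0.
    by apply: fFm; case: omegaP => /is_basis_mem wF _ _; apply: wF.
  have /eqP wH0 : cl0 (wH i) == 0 by rewrite cl0_W1 wH_W.
  rewrite memv_phi_F /= fv2 wH0 -lE mul0r => /andP[+ _].
  rewrite wH_image lg0; under eq_bigr do rewrite xE.
  move=> lw0; rewrite mxE [RHS]mxE [(PH *m _) _ _]mxE.
  apply: (mulfI (tate_gen_neq0 R 1)); rewrite mulr0 mulrDr mulr_sumr.
  apply: etrans (eqP lw0); rewrite [X in X + _]mulrC; congr (_ + _).
  by apply: eq_bigr => j _; rewrite mulrCA [complex_mx _ _ _]mxE.
have : f w1 \in phi_F H h 0.
  by apply: fFm; case: omegaP => /is_basis_mem wF _ _; apply: wF.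
have w11 : cl0 w1 = 1 by case: omegaP.
rewrite memv_phi_F /= fv2 w11 -lE mul1r => /andP[/eqP <- _].
rewrite w1_image lg0 x0E; under eq_bigr do rewrite xE.
rewrite !mulrDr [_ * c]mulrC [(a *m _) _ _]mxE mulr_sumr; congr (_ + _ + _).
by apply: eq_bigr => j _; rewrite mulrCA [complex_mx _ _ _]mxE.
Qed.

(** A linear map f prescribed on gamma by the data x, x0 and y.  The equation
    for y, with witness d, places the H-component of f(omega_(k+1)) in F^0 H. *)
Section PhiMap.
Variables (x : 'cV[R]_(k + k)) (x0 : R).
Variables (y : 'rV[R]_(k + k)) (d : 'rV[R[i]]_k) (f : 'Hom(BR, Y)).
Hypothesis wH_eq : b + PH *m complex_mx x = 0.
Hypothesis w1_eq :
  h%:C = tate_gen R 1 * (c + (a *m complex_mx x) ord0 ord0 + x0%:C).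
Hypothesis y_eq : a + complex_mx y = d *m PH.
Hypothesis fg0 : f g0 = (tate_gen R 1, 0, 0).
Hypothesis fgH : forall j,
  f (gH j) = (tate_gen R 1 * (x j ord0)%:C, cl1 (gH j), 0).
Hypothesis fg1 : f g1 =
  (tate_gen R 1 * x0%:C, \sum_j (y ord0 j)%:C *: cl1 (gH j), 1).

Let l := (phi_pr2 H \o f)%VF.
Let m := (phi_pr1 H \o f)%VF.
Let t := (phi_pr0 H \o f)%VF.

Let lE v : l v = (f v).1.1. Proof. by rewrite comp_lfunE phi_pr2E. Qed.
Let mE v : m v = (f v).1.2. Proof. by rewrite comp_lfunE phi_pr1E. Qed.
Let tE v : t v = (f v).2. Proof. by rewrite comp_lfunE phi_pr0E. Qed.

Lemma phi_map_cl0 v : (f v).2 = cl0 v.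
Proof.
rewrite -tE; have [z ->] := gamma_sum v; rewrite cl0_sum linear_sum.
under eq_bigr do rewrite linearZ /= tE.
rewrite sum_gamma fg0 fg1 /= scaler0 add0r big1 ?add0r => [|j _].
  exact: mulr1.
by rewrite fgH scaler0.
Qed.

Lemma phi_map_cl1 v : v \in W (-1) -> (f v).1.2 = cl1 v.
Proof.
move=> /W1_sum[z0 [z ->]]; rewrite -mE cl1_W1_sum linearD linearZ linear_sum /=.
rewrite mE fg0 scaler0 add0r.
by apply: eq_bigr => j _; rewrite linearZ /= mE fgH.
Qed.

Lemma phi_map_cl2 v : v \in W (-2) -> (f v).1.1 = cl2 v.
Proof.
by move=> /W2_sum[z0 ->]; rewrite -lE !linearZ /= lE fg0 cl2_g0.
Qed.

Lemma phi_map_conj v : f (rv_conj v) = phi_conj (f v).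
Proof.
have f_real j : phi_conj (f (gamma j)) = f (gamma j).
  have tate_real m' (r : R) :
      tate_conj m' (tate_gen R m' * r%:C) = tate_gen R m' * r%:C.
    rewrite /tate_conj [tate_gen R m' * _ / _]mulrAC divff ?tate_gen_neq0 //.
    by rewrite mul1r conjc_real.
  have real0 : tate_conj 0 0 = 0 :> R[i].
    by have := tate_real 0%N 0; rewrite mulr0.
  have real1 : tate_conj 0 1 = 1 :> R[i].
    by have := tate_real 0%N 1; rewrite mulr1.
  have real_gen : tate_conj 1 (tate_gen R 1) = tate_gen R 1.
    by have := tate_real 1%N 1; rewrite mulr1.
  have [j' ->|j' ->] := split_ordP j.
    by rewrite (ord1 j') fg0 /phi_conj /= real_gen real0 rv_conj0.
  have [i ->|i ->] := split_ordP j'.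
    by rewrite fgH /phi_conj /= tate_real real0 cl1_gH_real.
  rewrite (ord1 i) fg1 /phi_conj /= tate_real real1 rv_conj_sum.
  congr (_, _, _); apply: eq_bigr => j'' _.
  by rewrite conjc_real cl1_gH_real.
have [z ->] := gamma_sum v.
rewrite rv_conj_sum !linear_sum.
have phi_sum := @rv_conj_sum R (phi_vect H) _ z (fun j => f (gamma j)).
transitivity (phi_conj (\sum_j z j *: f (gamma j) : phi_vect H)); last first.
  by congr phi_conj; apply: eq_bigr => j _; rewrite linearZ.
rewrite [RHS]phi_sum; apply: eq_bigr => j _.
by rewrite linearZ /= gamma_real f_real.
Qed.

Lemma phi_map_W n v : v \in W n -> f v \in phi_W H n.
Proof.
move=> vW; rewrite memv_phi_W.
have up q : n <= q -> v \in W q.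
  by move=> nq; apply: subvP vW; apply: mhs_W_incr.
have [n0|n0] := lerP 0 n.
  by rewrite !(le_trans _ n0).
have v1 : v \in W (-1) by apply: up; lia.
have -> /= : (f v).2 == 0 by rewrite phi_map_cl0 cl0_W1.
have [n1|n1] := lerP (-1) n; first by rewrite (le_trans _ n1).
have v2 : v \in W (-2) by apply: up; lia.
have -> /= : (f v).1.2 == 0 by rewrite phi_map_cl1 ?cl1_W2.
have [n2|n2] //= := lerP (-2) n; rewrite andbT.
have : v \in W (-3) by apply: up; lia.
by rewrite (bg_W_bot (be_grading B)) memv0 => /eqP->; rewrite linear0.
Qed.

Lemma phi_map_wH i : f (wH i) = (0, cl1 (wH i), 0).
Proof.
have /eqP wH0 : cl0 (wH i) == 0 by rewrite cl0_W1 wH_W.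
rewrite [LHS]surjective_pairing [X in (X, _)]surjective_pairing.
rewrite phi_map_cl0 wH0 phi_map_cl1 ?wH_W //; congr (_, _, _).
have /colP/(_ i) := wH_eq; rewrite mxE [RHS]mxE [(PH *m _) _ _]mxE => e0.
rewrite -lE wH_image lE fg0 /= -[RHS](mulr0 (tate_gen R 1)) -[X in _ = _ * X]e0.
rewrite mulrDr mulr_sumr [_ * b _ _]mulrC; congr (_ + _).
by apply: eq_bigr => j _; rewrite lE fgH mulrCA [complex_mx _ _ _]mxE.
Qed.

Lemma phi_map_w1 :
  (f w1).1.1 = h%:C /\ (f w1).1.2 = \sum_i d ord0 i *: cl1 (wH i).
Proof.
rewrite -lE -mE !w1_image; split.
  rewrite w1_eq !lE fg0 fg1 /=; under eq_bigr do rewrite lE fgH.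
  rewrite !mulrDr [_ * c]mulrC [(a *m _) _ _]mxE mulr_sumr.
  congr (_ + _ + _).
  by apply: eq_bigr => j _; rewrite mulrCA [complex_mx _ _ _]mxE.
rewrite sum_cl1_wH -y_eq !mE fg0 fg1 /= scaler0 add0r -big_split.
by apply: eq_bigr => j _; rewrite mE fgH /= -scalerDl !mxE.
Qed.

Lemma phi_map_F0 v : v \in F 0 -> f v \in phi_F H h 0.
Proof.
have [wF _ w11] := omegaP.
move=> /(is_basis_sum wF)[z ->]; rewrite linear_sum.
apply: memv_suml => i _; rewrite linearZ; apply: memvZ.
rewrite memv_phi_F /=; have [j ->|j ->] := split_ordP i.
  rewrite phi_map_wH /= mul0r eqxx.
  exact: is_basis_mem cl1_wH_basis.
rewrite (ord1 j) phi_map_cl0 w11 mul1r.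
have [-> ->] := phi_map_w1; rewrite eqxx.
by apply: memv_suml => l' _; apply/memvZ/(is_basis_mem _ cl1_wH_basis).
Qed.

(** Only F^0 involves h.  For p < 0, subtracting a multiple of omega_(k+1),
    which lies in F^p, reduces to W_(-1), where f is the class in H; for p > 0,
    F^p is contained in F^0 and has zero class in Gr_0. *)
Lemma phi_map_F p v : v \in F p -> f v \in phi_F H h p.
Proof.
case: (ltrgtP p 0) => [p0|p0|->] vF; last exact: phi_map_F0.
- have [wF _ w11] := omegaP.
  have FpF0 : (F 0 <= F p)%VS by apply: mhs_F_decr; apply: ltW.
  have w1F : w1 \in F p by apply: (subvP FpF0); apply: is_basis_mem wF.
  have HFpF0 : (hs_F H 0 <= hs_F H p)%VS by apply: hs_F_decr; apply: ltW.
  pose v' := v - cl0 v *: w1.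
  have v'W : v' \in W (-1).
    by rewrite -cl0_W1 linearB linearZ /= w11 [_ *: _]mulr1 subrr.
  have v'F : v' \in F p by rewrite rpredB ?memvZ.
  rewrite memv_phi_F lt_eqF // (ltW p0) andbT.
  have -> /= : p <= -1 by lia.
  rewrite -(subrK (cl0 v *: w1) v) -/v' linearD linearZ /= rpredD //.
    by rewrite phi_map_cl1 //; apply: gr_class_F.
  apply: memvZ; have [_ ->] := phi_map_w1; apply: memv_suml => i _.
  by apply/memvZ/(subvP HFpF0)/(is_basis_mem _ cl1_wH_basis).
have v0F : f v \in phi_F H h 0.
  by apply: phi_map_F0; apply: subvP vF; apply: mhs_F_decr; apply: ltW.
have : cl0 v \in hs_F (tate R 0) p by apply: gr_class_F _ (W0_full v) vF.
rewrite memv_tate_F leNgt p0 /= => cl0v.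
have v1 : v \in W (-1) by rewrite -cl0_W1.
move: v0F; rewrite !memv_phi_F (gt_eqF p0) eqxx phi_map_cl0 (eqP cl0v) mul0r.
move=> /= /andP[-> _]; rewrite eqxx !orbT phi_map_cl1 // andbT.
exact: gr_class_F _ v1 vF.
Qed.

Lemma phi_map_isom : biext_isom BR Y.
Proof.
apply: (@morphism_biext_isom _ _ BR Y f).
- exact: phi_map_W.
- exact: phi_map_F.
- by move=> v v2; rewrite phi_class2 ?phi_map_W // phi_map_cl2.
- by move=> v v1; rewrite phi_class1 ?phi_map_W // phi_map_cl1.
- by move=> v _; rewrite phi_class0 phi_map_cl0.
exact: phi_map_conj.
Qed.

End PhiMap.

(** Together with [period_heightP] this says that phi(h) is isomorphic to B for
    exactly one h. *)
Lemma isom_phiP : biext_isom BR Y <->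
  exists (x : 'cV[R]_(k + k)) (x0 : R), b + PH *m complex_mx x = 0 /\
    h%:C = tate_gen R 1 * (c + (a *m complex_mx x) ord0 ord0 + x0%:C).
Proof.
split=> [|[x [x0 [wH_eq w1_eq]]]]; first exact: isom_phi_equations.
have [y [d y_eq]] := real_combination_complement a period_unitmx.
have [f fE] := basis_extend (fun j =>
  match fintype.split j return phi_vect H with
  | inl _ => (tate_gen R 1, 0, 0)
  | inr j' => match fintype.split j' with
    | inl i => (tate_gen R 1 * (x i ord0)%:C, cl1 (gH i), 0)
    | inr _ => (tate_gen R 1 * x0%:C, \sum_j (y ord0 j)%:C *: cl1 (gH j), 1)
    end
  end) gamma_basis.
apply: (@phi_map_isom x x0 y d f) => //.
- by rewrite fE (unsplitK (inl _)).
- by move=> j; rewrite fE (unsplitK (inr _)) (unsplitK (inl _)).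
by rewrite fE (unsplitK (inr _)) (unsplitK (inr _)).
Qed.

End TargetPhi.
End PeriodMatrix.

Theorem theorem2p9 (R : realType) (H : intHS R (-1)) (k : nat)
    (rkH : \dim {: H} = (k + k)%N) (B : biext H)
    (P : 'M[R[i]]_(k + 1, 1 + ((k + k) + 1))) (hP : is_period_matrix B P) :
  exists (b : 'cV[R[i]]_k) (PH : 'M[R[i]]_(k, k + k))
         (a : 'rV[R[i]]_(k + k)) (c : R[i]),
    [/\ P = block_mx b (row_mx PH 0) c%:M (row_mx a 1%:M),
        col_mx (Im_mx PH) (Re_mx PH) \in unitmx
      & height B =
        - (2 * pi) *
        (complex.Im c
         - (Im_mx a *m invmx (col_mx (Im_mx PH) (Re_mx PH))
            *m col_mx (Im_mx b) (Re_mx b)) ord0 ord0)].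
Proof.
have [gamma [omega [gammaP omegaP PE]]] := hP.
have uM := period_unitmx gammaP omegaP PE.
eexists _, _, _, _; split; [exact: period_block gammaP omegaP PE | exact: uM |].
have isomE h := iff_trans (isom_phiP rkH gammaP omegaP PE h)
  (iff_sym (period_heightP _ _ _ h uM)).
by apply: xget_unique => [|h /isomE]; first exact/isomE.
Qed.
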